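(* Let $l,d\in\mathbb{N}$, let $\Omega\subseteq\mathbb{M}^l$ be a nc domain, and let $\mathbb{D}_Q\subset\mathbb{M}^d$ be a nc operator ball. If $F:\Omega\to\overline{\mathbb{D}_Q}$ is a nc map such that $F(X_0)\in\partial\mathbb{D}_Q$ for some $X_0\in\Omega$, then $F(\Omega)\subseteq\partial\mathbb{D}_Q$. In particular, if $F:\Omega\to\overline{\mathbb{D}_Q}$ is a nc map such that $F(X)\in\mathbb{D}_Q$ for some $X\in\Omega$, then $F(\Omega)\subseteq\mathbb{D}_Q$.
   Context: $M_n^d$ is the set of $d$-tuples of complex $n\times n$ matrices; $\mathbb{M}^d=\sqcup_{n\ge1}M_n^d$; for $\Omega\subseteq\mathbb{M}^d$, $\Omega(n)=\Omega\cap M_n^d$. $\Omega$ is a nc set if it is closed under direct sums, and a nc domain if it is a nc set with every $\Omega(n)$ open. A nc map $f:\Omega\to\mathbb{M}^d$ is a map that is graded ($X\in\Omega(n)\Rightarrow f(X)\in M_n^d$), satisfies $f(X\oplus Y)=f(X)\oplus f(Y)$, and $f(S^{-1}XS)=S^{-1}f(X)S$ whenever $S\in GL_n$ and $X,S^{-1}XS\in\Omega(n)$. NC operator ball: given Hilbert spaces $\mathcal{R},\mathcal{S}$ and linearly independent $Q_1,\dots,Q_d\in\mathcal{L}(\mathcal{R},\mathcal{S})$, put $Q(X)=\sum_jQ_j\otimes X_j$ for $X\in\mathbb{M}^d$ and $\mathbb{D}_Q=\{X\in\mathbb{M}^d:\|Q(X)\|<1\}$. Then $\overline{\mathbb{D}_Q}=\{X:\|Q(X)\|\le1\}$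 is the level-wise closure and $\partial\mathbb{D}_Q=\overline{\mathbb{D}_Q}\setminus\mathbb{D}_Q=\{X:\|Q(X)\|=1\}$. *)

(* Defs.v *)
(* The complex numbers are R[i], for an arbitrary R : realType. *)
From HB Require Import structures.
From mathcomp Require Import all_boot all_order all_algebra.
From mathcomp Require Import complex.
From mathcomp Require Import all_classical all_reals all_analysis.

Set Implicit Arguments.
Unset Strict Implicit.
Unset Printing Implicit Defensive.

Import Order.TTheory GRing.Theory Num.Theory.
Import numFieldNormedType.Exports.

Local Open Scope classical_set_scope.
Local Open Scope ring_scope.

(* The numFieldType topology, made canonical on the bare type R[i]. *)
#[non_forgetful_inheritance]
HB.instance Definition _ (R : realType) := PseudoPointedMetric.copy R[i] R[i]^o.

Section NcSets.
Variable R : realType.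

(* Matrix sizes start at 1: index n stands for the level M_{n+1}^d, with the
   product topology. *)
Definition mxtuple (d n : nat) := {ptws 'I_d -> 'M[R[i]]_n.+1}.

(* A subset Omega of the disjoint union M^d, given by its levels Omega(n+1). *)
Definition ncsubset (d : nat) := forall n, set (mxtuple d n).

(* A graded map M^l -> M^d; a map on Omega is such a map up to its irrelevant
   values outside Omega. *)
Definition graded_map (l d : nat) := forall n, mxtuple l n -> mxtuple d n.

(* The size n.+1 + m.+1 of the direct sum is convertible to (n + m.+1).+1. *)
Definition dsum d n m (X : mxtuple d n) (Y : mxtuple d m) :
    mxtuple d (n + m.+1) :=
  fun j => block_mx (X j) 0 0 (Y j).

Definition simil d n (S : 'M[R[i]]_n.+1) (X : mxtuple d n) : mxtuple d n :=
  fun j => invmx S *m X j *m S.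

Definition nc_set d (Omega : ncsubset d) : Prop :=
  forall n m (X : mxtuple d n) (Y : mxtuple d m),
    Omega n X -> Omega m Y -> Omega (n + m.+1)%N (dsum X Y).

Definition nc_domain d (Omega : ncsubset d) : Prop :=
  nc_set Omega /\ forall n, open (Omega n).

Definition nc_map l d (Omega : ncsubset l) (f : graded_map l d) : Prop :=
  (forall n m (X : mxtuple l n) (Y : mxtuple l m),
      Omega n X -> Omega m Y ->
      f (n + m.+1)%N (dsum X Y) = dsum (f n X) (f m Y)) /\
  (forall n (X : mxtuple l n) (S : 'M[R[i]]_n.+1),
      S \in unitmx -> Omega n X -> Omega n (simil S X) ->
      f n (simil S X) = simil S (f n X)).

End NcSets.

Section OperatorBall.
Variable R : realType.

(* A complex Banach space is a Hilbert space when its norm comes from an inner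
   product; the inner product is then determined by polarization. *)
Definition is_hilbert (V : completeNormedModType R[i]) : Prop :=
  exists ip : {dot V for (@Num.conj R[i])}, forall x : V, `|x| ^+ 2 = ip x x.

Variables H K : completeNormedModType R[i].

Definition lin_independent d (Q : 'I_d -> {linear H -> K}) : Prop :=
  forall c : 'I_d -> R[i],
    (forall x : H, \sum_(j < d) c j *: Q j x = 0) -> forall j, c j = 0.

(* The Hilbert space tensor product V (x) C^n is realized as the n-fold Hilbert
   sum of V, an element being x = sum_k x_k (x) e_k; this is its norm. Norms of
   V take their values in R[i], hence the real part. *)
Definition l2norm (V : completeNormedModType R[i]) n (x : 'I_n -> V) : R :=
  Num.sqrt (\sum_(k < n) complex.Re `|x k| ^+ 2).

(* Q(X) = sum_j Q_j (x) X_j : H (x) C^{n+1} -> K (x) C^{n+1}. *)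
Definition pencil d (Q : 'I_d -> {linear H -> K}) n (X : mxtuple R d n)
    (x : 'I_n.+1 -> H) : 'I_n.+1 -> K :=
  fun i => \sum_(j < d) \sum_(k < n.+1) X j i k *: Q j (x k).

Definition opnorm n (T : ('I_n -> H) -> ('I_n -> K)) : \bar R :=
  ereal_sup [set (l2norm (T x))%:E | x in [set x | l2norm x <= 1]].

Definition ncball d (Q : 'I_d -> {linear H -> K}) : ncsubset R d :=
  fun n => [set X | (opnorm (pencil Q X) < 1)%E].
#[global] Arguments ncball {d} Q n _.

Definition ncball_closure d (Q : 'I_d -> {linear H -> K}) : ncsubset R d :=
  fun n => closure (ncball Q n).
#[global] Arguments ncball_closure {d} Q n _.

Definition ncball_boundary d (Q : 'I_d -> {linear H -> K}) : ncsubset R d :=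
  fun n => ncball_closure Q n `\` ncball Q n.
#[global] Arguments ncball_boundary {d} Q n _.

End OperatorBall.

(* Main.v *)
(* Let X, Y be points of Omega, A = F(X), D = F(Y), and suppose that Q(A) has
   norm at most r < 1. For a small t > 0, Omega contains the conjugate of the
   direct sum of X and Y by the shear with corner t E_{0k}, and F maps it to the
   block matrix with diagonal A, D and corner t (A E_{0k} - E_{0k} D). As Q of
   this matrix is a contraction, testing it on (0, v) with |v| <= 1 and putting
   s = |Q(D) v|^2 gives |Q(A)(v_k (x) e_0)_0 - (Q(D) v)_k|^2 <= (1 - s) / t^2,
   so |(Q(D) v)_k| <= r |v_k| + sqrt (1 - s) / t. Summing over k,
   s <= r + C (1 - s) with C independent of v, hence Q(D) has norm < 1 too. *)
Require Import Defs.
From mathcomp Require Import all_boot all_order all_algebra.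
From mathcomp Require Import complex.
From mathcomp Require Import all_classical all_reals all_analysis.
From mathcomp Require Import ring lra.

Set Implicit Arguments.
Unset Strict Implicit.
Unset Printing Implicit Defensive.

Import Order.TTheory GRing.Theory Num.Theory.
Import numFieldNormedType.Exports.

Local Open Scope classical_set_scope.
Local Open Scope ring_scope.

(** * Norms of complex normed spaces as real numbers *)

Section RealNorm.
Variables (R : realType) (V : normedModType R[i]).
Implicit Types x y : V.

(** Norms over [R[i]] are complex numbers with zero imaginary part; the real part loses nothing and
    allows real square roots and inequalities. *)
Definition rnorm x : R := complex.Re `|x|.

Lemma rnormE x : `|x| = (rnorm x)%:C%C.
Proof. by rewrite /rnorm RRe_real // ger0_real. Qed.

Lemma rnorm_ge0 x : 0 <= rnorm x.
Proof. by rewrite -ler0c -rnormE. Qed.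

Lemma rnorm0 : rnorm 0 = 0.
Proof. by rewrite /rnorm normr0. Qed.

Lemma rnormD x y : rnorm (x + y) <= rnorm x + rnorm y.
Proof. by rewrite -lecR rmorphD /= -!rnormE ler_normD. Qed.

Lemma rnormB x y : rnorm (x - y) = rnorm (y - x).
Proof. by rewrite /rnorm distrC. Qed.

Lemma rnormZ (t : R) x : 0 <= t -> rnorm (t%:C%C *: x) = t * rnorm x.
Proof.
move=> t0; apply: complexI; rewrite -rnormE normrZ rmorphM /= -rnormE.
by rewrite ger0_norm // ler0c.
Qed.

Lemma rnorm_continuous : continuous rnorm.
Proof.
move=> x; apply/pseudometric_normed_Zmodule.cvgrPdist_lt => e e0.
have e0' : 0 < e%:C%C by rewrite ltcR.
have /pseudometric_normed_Zmodule.cvgrPdist_lt/(_ _ e0') : id y @[y --> x] --> x by [].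
apply: filterS => y /=; rewrite rnormE ltcR; apply: le_lt_trans.
have h1 := rnormD (x - y) y; have h2 := rnormD (y - x) x.
move: h1 h2; rewrite !subrK (rnormB y x) => h1 h2.
by rewrite ler_norml; apply/andP; split; lra.
Qed.

End RealNorm.

(** * Continuity in the topology of matrix tuples *)

Section MatrixTuples.
Variable R : realType.

Lemma entry_continuous d n (j : 'I_d) i k :
  continuous (fun X : mxtuple R d n => X j i k : R[i]).
Proof.
move=> X.
apply: (continuous_comp (g := fun A : 'M[R[i]]_n.+1 => A i k)).
  by have := @proj_continuous 'I_d (fun=> 'M[R[i]]_n.+1) j X; exact.
exact: coord_continuous.
Qed.

Lemma mxtuple_continuous (T : topologicalType) d n (f : T -> mxtuple R d n) :
  (forall j, continuous (fun t => f t j)) -> continuous f.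
Proof.
move=> cf t; apply/cvg_sup => j; move: t.
(* The product topology is the supremum of the initial topologies of the projections; the open sets
   of [W] are preimages of open sets of matrices. *)
pose W := initial_topology (fun g : mxtuple R d n => g j).
apply/(@continuousP _ W) => A [B oB <-]; rewrite -comp_preimage.
by move/continuousP: (cf j); apply.
Qed.

Lemma pencil_continuous (H K : completeNormedModType R[i]) d
    (Q : 'I_d -> {linear H -> K}) n (x : 'I_n.+1 -> H) i :
  continuous (fun X : mxtuple R d n => pencil Q X x i).
Proof.
move=> X; have FX : Filter (nbhs X) by exact: nbhs_filter.
apply: (@cvg_big _ _ _ _ _ _ _ (nbhs X)) => [|j _]; first exact: add_continuous.
apply: (@cvg_big _ _ _ _ _ _ _ (nbhs X)) => [|k _]; first exact: add_continuous.
exact: (@cvgZr_tmp _ K _ (nbhs X) FX _ _ _ (@entry_continuous d n j i k X)).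
Qed.

Lemma mx_continuous (T U : topologicalType) m n (f : T -> 'M[U]_(m, n)) :
  (forall i k, continuous (fun t => f t i k)) -> continuous f.
Proof.
move=> cf t A [P nP PA]; apply: (@filterS _ _ _ _ _ PA).
apply: filter_forall => i; apply: filter_forall => k.
exact: cf (nP i k).
Qed.

(** Shear conjugates of a direct sum lie on such a line, so an open level contains them for small
    [t]. *)
Lemma affine_continuous d n (X M : mxtuple R d n) :
  continuous (fun t : R[i] => (fun j => X j + t *: M j) : mxtuple R d n).
Proof.
apply: mxtuple_continuous => j; apply: mx_continuous => i k.
have -> : (fun t : R[i] => (X j + t *: M j) i k) =
    (fun t => X j i k + t * M j i k) by apply/funext => t; rewrite !mxE.
move=> t.
have Ft : Filter (nbhs t) by exact: nbhs_filter.
apply: (@cvgD _ (R[i]^o) _ (nbhs t) Ft); first exact: cvg_cst.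
exact: (@cvgZr_tmp _ (R[i]^o) _ (nbhs t) Ft _ _ _ cvg_id).
Qed.
End MatrixTuples.

(** * Conjugation of a direct sum by a shear *)

Section Shear.
Variable R : realType.

Definition shear n m (E : 'M[R[i]]_(n.+1, m.+1)) : 'M[R[i]]_((n + m.+1).+1) :=
  block_mx 1%:M E 0 1%:M : 'M[R[i]]_(n.+1 + m.+1).

Definition corner d n m (E : 'M[R[i]]_(n.+1, m.+1))
    (X : mxtuple R d n) (Y : mxtuple R d m) : mxtuple R d (n + m.+1) :=
  fun j => block_mx 0 (X j *m E - E *m Y j) 0 0 : 'M[R[i]]_(n.+1 + m.+1).

Lemma shearNM n m (E : 'M[R[i]]_(n.+1, m.+1)) : shear (- E) *m shear E = 1%:M.
Proof.
(* The block sizes are explicit because [(n + m.+1).+1] is only convertible to [n.+1 + m.+1]. *)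
rewrite [LHS](@mulmx_block _ n.+1 m.+1 n.+1 m.+1 n.+1 m.+1).
rewrite !mul1mx !mulmx1 !mul0mx !mulmx0 !addr0 !add0r subrr.
by rewrite -scalar_mx_block.
Qed.

Lemma shear_unit n m (E : 'M[R[i]]_(n.+1, m.+1)) : shear E \in unitmx.
Proof. by have /mulmx1_unit[] := shearNM E. Qed.

Lemma invmx_shear n m (E : 'M[R[i]]_(n.+1, m.+1)) : invmx (shear E) = shear (- E).
Proof. by rewrite -[LHS]mul1mx -(shearNM E) mulmxK // shear_unit. Qed.

(** There is no quadratic term in [t]: it would have the zero lower left block of [dsum X Y] as a
    factor. *)
Lemma simil_shear d n m (E : 'M[R[i]]_(n.+1, m.+1)) (X : mxtuple R d n)
    (Y : mxtuple R d m) (t : R[i]) :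
  simil (shear (t *: E)) (dsum X Y) = (fun j => dsum X Y j + t *: corner E X Y j).
Proof.
apply/funext => j; rewrite /simil invmx_shear /shear /dsum /corner.
rewrite [X in X *m _](@mulmx_block _ n.+1 m.+1 n.+1 m.+1 n.+1 m.+1).
rewrite [LHS](@mulmx_block _ n.+1 m.+1 n.+1 m.+1 n.+1 m.+1).
rewrite [X in _ = _ + X](@scale_block_mx _ n.+1 m.+1 n.+1 m.+1).
rewrite [RHS](@add_block_mx _ n.+1 m.+1 n.+1 m.+1).
rewrite !mul1mx !mulmx1 !mul0mx !mulmx0 !scaler0 !addr0 !add0r mulNmx.
by rewrite scalerBr scalemxAr scalemxAl mul0mx add0r.
Qed.

End Shear.

(** * Norm estimates for pencils in the open and closed ball *)

Section Pencil.
Variables (R : realType) (H K : completeNormedModType R[i]).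

Lemma l2normE (V : completeNormedModType R[i]) n (x : 'I_n -> V) :
  l2norm x = Num.sqrt (\sum_(k < n) rnorm (x k) ^+ 2).
Proof. by []. Qed.

Lemma l2norm_le1 (V : completeNormedModType R[i]) n (x : 'I_n -> V) :
  (l2norm x <= 1) = (\sum_(k < n) rnorm (x k) ^+ 2 <= 1).
Proof. by rewrite l2normE -{1}sqrtr1 ler_sqrt. Qed.

Lemma rnorm_le_l2norm (V : completeNormedModType R[i]) n (x : 'I_n -> V) k :
  rnorm (x k) <= l2norm x.
Proof.
rewrite -[leLHS]ger0_norm ?rnorm_ge0 // -sqrtr_sqr l2normE ler_wsqrtr //.
by rewrite (bigD1 k) //= lerDl sumr_ge0 // => i _; apply: sqr_ge0.
Qed.

Lemma l2normZ (V : completeNormedModType R[i]) n (c : R) (x : 'I_n -> V) :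
  0 <= c -> l2norm (fun k => c%:C%C *: x k) = c * l2norm x.
Proof.
move=> c0; rewrite !l2normE.
under eq_bigr do rewrite rnormZ // exprMn.
by rewrite -mulr_sumr sqrtrM ?sqr_ge0 // sqrtr_sqr ger0_norm.
Qed.

Lemma pencilZ d (Q : 'I_d -> {linear H -> K}) n (X : mxtuple R d n) c x i :
  pencil Q X (fun k => c *: x k) i = c *: pencil Q X x i.
Proof.
rewrite /pencil scaler_sumr; apply: eq_bigr => j _.
rewrite scaler_sumr; apply: eq_bigr => k _.
by rewrite linearZ /= !scalerA mulrC.
Qed.

(** For fixed [x] the norm is continuous in the matrix tuple, so the inequality cuts out a closed
    set, and this set contains the open ball. *)
Lemma ncball_closure_contractive d (Q : 'I_d -> {linear H -> K}) n
    (X : mxtuple R d n) x :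
  ncball_closure Q n X -> l2norm x <= 1 -> l2norm (pencil Q X x) <= 1.
Proof.
move=> QX x1; pose g (Y : mxtuple R d n) := l2norm (pencil Q Y x).
have cg : continuous g.
  move=> Y; apply: (@continuous_comp _ _ _ _ Num.sqrt); last exact: sqrt_continuous.
  have FY : Filter (nbhs Y) by exact: nbhs_filter.
  apply: (@cvg_big _ _ _ _ _ _ _ (nbhs Y)) => [|k _]; first exact: add_continuous.
  have ck : (fun Y => rnorm (pencil Q Y x k)) @ Y --> rnorm (pencil Q Y x k).
    have := @rnorm_continuous _ _ (pencil Q Y x k).
    exact: continuous_comp (@pencil_continuous _ _ _ _ Q _ x k Y).
  exact: (cvg_comp _ _ ck (@exprn_continuous R 2 (rnorm (pencil Q Y x k)))).
have : closed (g @^-1` [set z | z <= 1]).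
  apply: closed_comp; last exact: closed_le.
  by move=> Y _; exact: cg.
move/closure_id => gE; suff : closure (g @^-1` [set z | z <= 1]) X by rewrite -gE.
apply: closureS QX => Y /= /ltW /ereal_supP QY.
by rewrite -lee_fin; apply: QY; exists x.
Qed.

Lemma ncball_bound d (Q : 'I_d -> {linear H -> K}) n (X : mxtuple R d n) :
  ncball Q n X -> exists r : R, [/\ 0 <= r, r < 1 &
    forall x, l2norm (pencil Q X x) <= r * l2norm x].
Proof.
(* The maximum with 0 gives [0 <= r] at once, whatever the sign of the supremum. *)
rewrite /ncball /= => QX; pose r := Num.max 0 (fine (opnorm (pencil Q X))).
have r0 : 0 <= r by rewrite le_max lexx.
have r1 : r < 1.
  rewrite gt_max ltr01 /=; move: QX.
  by case: (opnorm _) => [s||] //=; rewrite lte_fin.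
have Xr : (opnorm (pencil Q X) <= r%:E)%E.
  move: QX; rewrite /r; case: (opnorm _) => [s||] //= _; last by rewrite leNye.
  by rewrite lee_fin le_max lexx orbT.
have hc x (c : R) : 0 <= c -> c * l2norm x <= 1 -> c * l2norm (pencil Q X x) <= r.
  move=> c0 cx; rewrite -l2normZ // -lee_fin.
  move/ereal_supP: Xr; apply.
  exists (fun k => c%:C%C *: x k); first by rewrite /= l2normZ.
  by congr (l2norm _)%:E; apply/funext => i; rewrite pencilZ.
exists r; split => // x.
have : 0 <= l2norm x by exact: sqrtr_ge0.
rewrite le_eqVlt => /orP[/eqP x0|x0].
  rewrite -x0 mulr0 leNgt; apply/negP => p0.
  (* All multiples of a vector of norm 0 lie in the unit ball; this one would have an image of norm
     [r + 1]. *)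
  have := hc x ((r + 1) / l2norm (pencil Q X x)).
  by rewrite -x0 mulr0 ler01 divfK ?gt_eqF // divr_ge0 ?(ltW p0) //; lra.
rewrite mulrC -ler_pdivrMl //; apply: hc; first by rewrite invr_ge0 ltW.
by rewrite mulVf // gt_eqF.
Qed.

(** The bound [q] is uniform in [x]: the supremum need not be attained, so pointwise strict
    inequalities would not suffice. *)
Lemma ncball_sumsq d (Q : 'I_d -> {linear H -> K}) n (X : mxtuple R d n) (q : R) :
  q < 1 ->
  (forall x, l2norm x <= 1 -> \sum_i rnorm (pencil Q X x i) ^+ 2 <= q) ->
  ncball Q n X.
Proof.
move=> q1 hq; rewrite /ncball /=.
apply: (@le_lt_trans _ _ (Num.sqrt q)%:E).
  apply/ereal_supP => _ [x /= x1 <-].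
  by rewrite lee_fin l2normE ler_wsqrtr // hq.
by rewrite lte_fin -sqrtr1 ltr_sqrt.
Qed.

End Pencil.

(** * From contractive sheared block matrices to a bound on the second block *)

Section Transfer.
Variables (R : realType) (H K : completeNormedModType R[i]).

(** The elementary tensor of [v] with the basis vector e_0. *)
Definition single (V : zmodType) n (v : V) : 'I_n.+1 -> V :=
  fun i => if i == 0 then v else 0.
#[global] Arguments single {V} n v _.

(** The vector (0, v), split along the blocks of [dsum]. *)
Definition inr_vec (V : zmodType) n m (v : 'I_m.+1 -> V) : 'I_(n + m.+1).+1 -> V :=
  fun i => if fintype.split (i : 'I_(n.+1 + m.+1)) is inr k then v k else 0.
#[global] Arguments inr_vec {V} n {m} v _.

Lemma l2norm_single (V : completeNormedModType R[i]) n (v : V) :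
  l2norm (single n v) = rnorm v.
Proof.
rewrite l2normE big_ord_recl big1 => [|i _]; last by rewrite rnorm0 expr0n.
by rewrite addr0 sqrtr_sqr ger0_norm // rnorm_ge0.
Qed.

Lemma l2norm_inr_vec (V : completeNormedModType R[i]) n m (v : 'I_m.+1 -> V) :
  l2norm (inr_vec n v) = l2norm v.
Proof.
rewrite !l2normE (@big_split_ord _ _ _ n.+1 m.+1) /= big1 ?add0r => [|i _].
  by congr Num.sqrt; apply: eq_bigr => i _; rewrite /inr_vec (unsplitK (inr i)).
by rewrite /inr_vec (unsplitK (inl i)) rnorm0 expr0n.
Qed.

Variables (d : nat) (Q : 'I_d -> {linear H -> K}).

Lemma pencil_single n (A : mxtuple R d n) v i :
  pencil Q A (single n v) i = \sum_(j < d) A j i 0 *: Q j v.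
Proof.
apply: eq_bigr => j _; rewrite big_ord_recl big1 ?addr0 // => k _.
by rewrite linear0 scaler0.
Qed.

Lemma pencil_inr_vec n m (T : mxtuple R d (n + m.+1)) v i :
  pencil Q T (inr_vec n v) i =
  \sum_(j < d) \sum_(k < m.+1) (T j : 'M[R[i]]_(n.+1 + m.+1)) i (rshift n.+1 k) *: Q j (v k).
Proof.
apply: eq_bigr => j _.
rewrite (@big_split_ord _ _ _ n.+1 m.+1) /= big1 ?add0r => [|k _].
  by apply: eq_bigr => k _; rewrite /inr_vec (unsplitK (inr k)).
by rewrite /inr_vec (unsplitK (inl k)) linear0 scaler0.
Qed.

Variables (n m : nat) (A : mxtuple R d n) (D : mxtuple R d m).

Definition sheared t k : mxtuple R d (n + m.+1) :=
  fun j => dsum A D j + t *: corner (delta_mx 0 k) A D j.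

Lemma pencil_sheared_r t k v i :
  pencil Q (sheared t k) (inr_vec n v) (rshift n.+1 i) = pencil Q D v i.
Proof.
rewrite pencil_inr_vec; apply: eq_bigr => j _; apply: eq_bigr => k' _.
rewrite mxE [X in (_ + X) *: _]mxE [X in X + _](@block_mxEdr _ n.+1 m.+1 n.+1 m.+1).
by rewrite [X in _ * X](@block_mxEdr _ n.+1 m.+1 n.+1 m.+1) mxE mulr0 addr0.
Qed.

(** Row 0 of A E_{0k} has its only possibly nonzero entry A_00 in column k, and row 0 of E_{0k} D is
    row k of D. *)
Lemma pencil_sheared_l t k v :
  pencil Q (sheared t k) (inr_vec n v) (lshift m.+1 0) =
  t *: (pencil Q A (single n (v k)) 0 - pencil Q D v k).
Proof.
rewrite pencil_inr_vec pencil_single -sumrB scaler_sumr; apply: eq_bigr => j _.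
have -> : A j 0 0 *: Q j (v k) = \sum_k' (A j *m delta_mx 0 k) 0 k' *: Q j (v k').
  rewrite (bigD1 k) //= big1 ?addr0 => [|k' k'k].
    rewrite mxE (bigD1 0) //= big1 ?addr0 => [|i i0]; last first.
      by rewrite mxE (negbTE i0) mulr0.
    by rewrite mxE !eqxx mulr1.
  rewrite mxE big1 ?scale0r // => i _.
  by rewrite mxE (negbTE k'k) andbF mulr0.
have -> : \sum_k' D j k k' *: Q j (v k') =
    \sum_k' ((delta_mx 0 k : 'M[R[i]]_(n.+1, m.+1)) *m D j) 0 k' *: Q j (v k').
  apply: eq_bigr => k' _; rewrite mxE (bigD1 k) //= big1 ?addr0 => [|i ik].
    by rewrite mxE !eqxx mul1r.
  by rewrite mxE (negbTE ik) mul0r.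
rewrite -sumrB scaler_sumr; apply: eq_bigr => k' _.
rewrite mxE [X in (_ + X) *: _]mxE [X in X + _](@block_mxEur _ n.+1 m.+1 n.+1 m.+1).
rewrite [X in _ * X](@block_mxEur _ n.+1 m.+1 n.+1 m.+1) mxE add0r.
by rewrite -scalerBl scalerA !mxE.
Qed.

Lemma sheared_contractive (t : R) : 0 < t -> ncball Q n A ->
  (forall k, ncball_closure Q _ (sheared t%:C%C k)) -> ncball Q m D.
Proof.
move=> t0 /ncball_bound[r [r0 r1 Ar]] QT.
(* [C] is the number of coordinates times the error factor in [hk]; solving s <= r + C (1 - s) for s
   gives the bound (r + C) / (1 + C) < 1. *)
pose C := m.+1%:R * ((1 - r) * t ^+ 2)^-1.
have r1' : 0 < 1 - r by rewrite subr_gt0.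
have rt0 : 0 < (1 - r) * t ^+ 2 by rewrite mulr_gt0 // exprn_gt0.
have C0 : 0 < C by rewrite mulr_gt0 ?invr_gt0 // ltr0n.
have C1 : 0 < 1 + C by rewrite addr_gt0.
apply: (@ncball_sumsq _ _ _ _ _ _ _ ((r + C) / (1 + C))).
  by rewrite ltr_pdivrMr // mul1r ltrD2r.
move=> v v1; set s := \sum_i _.
have hk k : rnorm (pencil Q D v k) ^+ 2 <=
    r * rnorm (v k) ^+ 2 + (1 - s) * ((1 - r) * t ^+ 2)^-1.
  set a := pencil Q A (single n (v k)) 0; set b := pencil Q D v k.
  (* The lower block contributes [s] and row 0 of the upper block the left-hand side; the remaining
     rows are nonnegative and dropped. *)
  have h1 : t ^+ 2 * rnorm (a - b) ^+ 2 <= 1 - s.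
    have := ncball_closure_contractive (QT k) (x := inr_vec n v).
    rewrite l2norm_inr_vec => /(_ v1); rewrite l2norm_le1.
    rewrite (@big_split_ord _ _ _ n.+1 m.+1) /= big_ord_recl.
    under [X in _ + X <= _]eq_bigr do rewrite pencil_sheared_r.
    rewrite pencil_sheared_l (rnormZ _ (ltW t0)) exprMn -/s -/a -/b.
    have : 0 <= \sum_(i < n) rnorm (pencil Q (sheared t%:C%C k) (inr_vec n v)
       (lshift m.+1 (lift ord0 i))) ^+ 2.
      by apply: sumr_ge0 => i _; apply: sqr_ge0.
    lra.
  have h2 : rnorm a <= r * rnorm (v k).
    by rewrite -(l2norm_single n (v k)); apply: le_trans (Ar _); apply: rnorm_le_l2norm.
  have h3 : rnorm b <= r * rnorm (v k) + rnorm (a - b).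
    by have := rnormD (b - a) a; rewrite subrK (rnormB b a); lra.
  have h4 : rnorm (a - b) ^+ 2 / (1 - r) <= (1 - s) * ((1 - r) * t ^+ 2)^-1.
    rewrite invfM mulrA ler_pdivlMr ?exprn_gt0 // mulrAC ler_pM2r ?invr_gt0 //.
    by rewrite mulrC.
  apply: le_trans (_ : (r * rnorm (v k) + rnorm (a - b)) ^+ 2 <= _).
    by rewrite ler_sqr // nnegrE ?addr_ge0 ?mulr_ge0 ?rnorm_ge0.
  apply: le_trans (lerD (lexx _) h4).
  (* Convexity of the square, for [r x + (1 - r) (y / (1 - r))]. *)
  set x := rnorm (v k); set y := rnorm (a - b).
  rewrite -subr_ge0.
  have -> : r * x ^+ 2 + y ^+ 2 / (1 - r) - (r * x + y) ^+ 2 =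
      r * ((1 - r) * x - y) ^+ 2 / (1 - r) by field; rewrite gt_eqF.
  by apply: mulr_ge0; [apply: mulr_ge0 => //; exact: sqr_ge0 | rewrite invr_ge0 ltW].
(* Sum [hk] over [k], using that the squares of the norms of the [v k] add up to at most 1. *)
have : s <= r + C * (1 - s).
  apply: le_trans (ler_sum _ (fun k _ => hk k)) _.
  rewrite big_split /= -mulr_sumr sumr_const card_ord -mulr_natl.
  rewrite l2norm_le1 in v1.
  apply: lerD; first by rewrite -[leRHS]mulr1 ler_wpM2l.
  by rewrite /C -mulrA [_ * (1 - s)]mulrC.
by rewrite ler_pdivlMr //; lra.
Qed.

End Transfer.

(** * Small shears inside the domain, and the dichotomy *)

Lemma nbhs0_real (R : realType) (A : set R[i]) :
  nbhs 0 A -> exists2 t : R, 0 < t & A t%:C%C.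
Proof.
move=> /(@nbhs_ballP _ R[i]^o)[e /= e0 eA].
have eE : (complex.Re e)%:C%C = e by rewrite RRe_real // gtr0_real.
have e0' : 0 < complex.Re e by rewrite -ltcR eE.
(* The radius [e] is positive in [R[i]], hence real; half of it lies strictly inside the ball. *)
exists (complex.Re e / 2); first by rewrite divr_gt0.
apply: eA; rewrite -ball_normE /= sub0r normrN ger0_norm ?ler0c ?divr_ge0 ?ltW //.
by rewrite -eE ltcR; lra.
Qed.

Lemma ncball_transfer (R : realType) (l d : nat) (Omega : ncsubset R l)
    (H K : completeNormedModType R[i]) (Q : 'I_d -> {linear H -> K})
    (F : graded_map R l d) :
  nc_domain Omega -> nc_map Omega F ->
  (forall n (X : mxtuple R l n), Omega n X -> ncball_closure Q n (F n X)) ->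
  forall n m (X : mxtuple R l n) (Y : mxtuple R l m),
    Omega n X -> Omega m Y -> ncball Q n (F n X) -> ncball Q m (F m Y).
Proof.
move=> [OD Oo] [FD FS] FQ n m X Y OX OY QX.
have OXY := OD _ _ _ _ OX OY.
(* One [t] serves all [k], as there are finitely many. *)
have [t t0 Ot] : exists2 t : R, 0 < t & forall k,
    Omega _ (simil (shear (t%:C%C *: delta_mx 0 k)) (dsum X Y)).
  apply: (@nbhs0_real R (fun t : R[i] => forall k,
    Omega _ (simil (shear (t *: delta_mx 0 k)) (dsum X Y)))).
  have F0 : Filter (nbhs (0 : R[i])) by exact: nbhs_filter.
  apply: (@filter_forall _ _ _ (nbhs (0 : R[i])) F0) => k.
  have /continuousP/(_ _ (Oo _)) oA :=
    affine_continuous (X := dsum X Y) (M := corner (delta_mx 0 k) X Y).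
  (* At [t = 0] the line passes through [dsum X Y], which lies in the open level. *)
  apply: filterS (open_nbhs_nbhs (conj oA _)) => [t|]; first by rewrite simil_shear.
  rewrite /preimage /= (_ : (fun j => _) = dsum X Y) //.
  by apply/funext => j; rewrite scale0r addr0.
apply: (sheared_contractive t0 QX) => k.
(* Both the direct sum and its conjugate lie in [Omega], so the sheared matrix built from [F n X]
   and [F m Y] is itself a value of [F]. *)
rewrite /sheared -simil_shear -FD // -FS ?shear_unit //.
exact: FQ.
Qed.

Theorem theorem3p2 (R : realType) (l d : nat) (Omega : ncsubset R l)
    (hOmega : nc_domain Omega)
    (H K : completeNormedModType R[i])
    (hH : is_hilbert H) (hK : is_hilbert K)
    (Q : 'I_d -> {linear H -> K})
    (Qbounded : forall j, continuous (Q j))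
    (Qindep : lin_independent Q)
    (F : graded_map R l d)
    (hF : nc_map Omega F)
    (Fclosure : forall n (X : mxtuple R l n),
        Omega n X -> ncball_closure Q n (F n X)) :
  ((exists n (X0 : mxtuple R l n),
       Omega n X0 /\ ncball_boundary Q n (F n X0)) ->
   forall n (X : mxtuple R l n),
     Omega n X -> ncball_boundary Q n (F n X)) /\
  ((exists n (X : mxtuple R l n), Omega n X /\ ncball Q n (F n X)) ->
   forall n (X : mxtuple R l n), Omega n X -> ncball Q n (F n X)).
Proof.
have transfer := ncball_transfer hOmega hF Fclosure.
split=> [[m [X0 [OX0 [_ X0_out]]]] n X OX|[m [X0 [OX0 X0_in]]] n X OX].
  (* A value in the open ball at [X] would transfer to [X0]. *)
  by split=> [|X_in]; [exact: Fclosure | exact/X0_out/(transfer _ _ X)].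
exact: transfer OX0 OX X0_in.
Qed.
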